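(* Let $N\ge 1$ be an integer (the number of floors) and let $k\ge 1$ be an integer (the number of eggs). Consider the one-dimensional critical point problem on the points $1,\dots,N$ with $k$ eggs, searched with the recursive jump-search strategy described in the context. In the worst-case scenario, the optimal step size $S_{1P;k}$ for the first egg under this strategy satisfies $$S_{1P;k}\ \le\ N^{(k-1)/k},$$ which leads to a minimum number $P_1(k)$ of egg drops satisfying $$P_1(k)\ \le\ \left\lceil k\cdot N^{1/k}\right\rceil .$$
   Context: One-dimensional critical point problem: among the numbers $1,\dots,N$ there is a unique unknown integer $n\in(0,N]$, the critical point, such that an egg dropped from a point $a<n$ remains intact and undamaged (and can be reused), while an egg dropped from a point $a\ge n$ breaks (and must be discarded). All eggs behave identically. The goal is to determine $n$ with at most $k$ broken eggs. The worst-case number of drops of a procedure is the number of drops that suffices whatever the value of $n$. Strategy. With one egg: test the points $1,2,3,\dots$ in increasing order until the egg breaks (linear search; step size $1$, counted as $N$ drops in the worst case). With $k\ge 2$ eggs: choose a step size $S_{1P;k}$ and drop the first egg at positions $i\cdot S_{1P;k}$ for $i=1,2,3,\dots$ until it breaks, say at $T\cdot S_{1P;k}$. The critical point then lies in $((T-1)S_{1P;k},\,T S_{1P;k}]$, which contains $S_{1P;k}$ candidate points, of which $S_{1P;k}-1$ still need to be tested. Apply the same strategy with the remaining $k-1$ eggs to these points, continuing recursively until one egg is left, at which stage a linear search is used. The optimal step size is the one minimizing the worst-case number of drops, and $P_1(k)$ is the resulting minimum worst-case number of drops. (Non-integer positions may be tested in the abstract setting of a number line; when positions must be integers the step size is rounded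 up to the nearest integer.) *)

(* Defs.v *)
From HB Require Import structures.
From mathcomp Require Import all_boot all_order all_algebra.
From mathcomp Require Import all_classical all_reals all_analysis.
From mathcomp Require Import zify.

Set Implicit Arguments.
Unset Strict Implicit.
Unset Printing Implicit Defensive.

Import Order.TTheory GRing.Theory Num.Theory.

(** * The search procedure on the points 1, ..., N

    [lo] is the highest point known to leave the egg intact (0 is the ground)
    and [hi] the lowest point that needs no further test: a point where an egg
    broke or, before any egg has broken, N + 1.  The points still to be tested
    are thus lo + 1, ..., hi - 1.  All N points are to be tested at the start,
    so that the linear search is counted as N drops, and S - 1 of them once the
    first egg has broken after jumps of length S. *)
Record state := State { lo : nat; hi : nat; drops : nat; broken : nat }.

Definition drop_egg (n a : nat) (st : state) : state :=
  if n <= a then State (lo st) a (drops st).+1 (broken st).+1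
  else State a (hi st) (drops st).+1 (broken st).

Definition jump (n s : nat) (st : state) : state :=
  if lo st + s < hi st then drop_egg n (lo st + s) st else st.

(** A schedule [:: S_k; ...; S_2; 1] lists the step sizes of the successive
    eggs; the last one makes a linear search.  N iterations exhaust the jumps
    of one egg; those after its break or past the last untested point do
    nothing, since then lo + s >= hi. *)
Definition search (N n : nat) (ss : seq nat) : state :=
  foldl (fun st s => iter N (jump n s) st) (State 0 N.+1 0 0) ss.

Definition schedule (k : nat) (ss : seq nat) : Prop :=
  [/\ size ss = k, last 0 ss = 1 & all (fun s => 1 <= s) ss].

Definition worst_drops (N : nat) (ss : seq nat) : nat :=
  \max_(n < N) drops (search N n.+1 ss).

Definition min_drops (N k P : nat) : Prop :=
  (exists2 ss, schedule k ss & worst_drops N ss = P) /\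
  (forall ss, schedule k ss -> P <= worst_drops N ss).

Local Open Scope ring_scope.

(** * The worst case on the number line

    Step sizes are real.  A stretch of x points takes x / S drops of the first
    egg, and the worst case leaves S - 1 points to the other eggs; the last
    step being 1, the linear search of x points counts x drops.  The lemma
    [search_drops_le] below relates this count to the procedure above.
    Steps are at least 1, for the number S - 1 of points left to be
    nonnegative (otherwise the count has no lower bound once k >= 3). *)
Fixpoint line_drops (R : realType) (ss : seq R) (x : R) : R :=
  if ss is s :: ss' then x / s + line_drops ss' (s - 1) else 0.

Definition line_schedule (R : realType) (k : nat) (ss : seq R) : Prop :=
  [/\ size ss = k, last 0 ss = 1 & all (fun s => 1 <= s) ss].

Definition optimal_schedule (R : realType) (k : nat) (x : R) (ss : seq R) :
    Prop :=
  line_schedule k ss /\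
  (forall tt, line_schedule k tt -> line_drops ss x <= line_drops tt x).

Definition optimal_step (R : realType) (k : nat) (x S : R) : Prop :=
  exists ss, optimal_schedule k x (S :: ss).

Definition min_line_drops (R : realType) (k : nat) (x P : R) : Prop :=
  exists2 ss, optimal_schedule k x ss & line_drops ss x = P.

Local Close Scope ring_scope.

Section Adequacy.
Variables (N n : nat).

Let good (st : state) := [/\ lo st < n, n <= hi st & hi st <= N.+1].

Let iter_jumpP s m st : 0 < s -> good st ->
  let st' := iter m (jump n s) st in good st' /\
  exists d, drops st' = drops st + d /\
    ([/\ broken st' = broken st, hi st' = hi st, lo st' = lo st + d * s &
        (lo st' + s < hi st -> d = m)] \/
     [/\ broken st' = (broken st).+1, hi st' = lo st' + s, hi st' < hi st &
        hi st' = lo st + d * s]).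
Proof.
move=> s0 gst /=; elim: m => [|m] /=.
  by split => //; exists 0; split; [lia|left; split => //; lia].
set st' := iter m _ st => -[[g1 g2 g3] [d [hd hor]]].
rewrite /jump; case: ifPn => [lt_hi|/negbTE nlt]; last first.
  split => //; exists d; split => //.
  by case: hor => -[b1 b2 b3 b4]; [left|right]; split => //; lia.
case: hor => -[b1 b2 b3 b4]; last by lia.
have dm : d = m by apply: b4; lia.
rewrite /drop_egg /good; case: ifPn => na /=; (split; first by split; lia);
  exists d.+1; (split; first by lia).
- by right; split; nia.
- by left; split; nia.
Qed.

Let iter_jump s st : 0 < s -> good st ->
  let st' := iter N (jump n s) st in
  [/\ good st', hi st' - lo st' <= s, broken st' <= (broken st).+1 &
    exists2 d, drops st' = drops st + d & d * s <= hi st - lo st - 1].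
Proof.
move=> s0 gst; have [[g1 g2 g3] [d [hd hor]]] := iter_jumpP N s0 gst.
move: gst => [i1 i2 i3]; split => //.
- by case: hor => -[b1 b2 b3 b4]; nia.
- by case: hor => -[b1 b2 b3 b4]; lia.
- by exists d => //; case: hor => -[b1 b2 b3 b4]; lia.
Qed.

Lemma search_correct k ss : 0 < n <= N -> 0 < k -> schedule k ss ->
  hi (search N n ss) = n /\ broken (search N n ss) <= k.
Proof.
move=> nN k0 [sk]; rewrite /search -sk.
have : good (State 0 N.+1 0 0) by split => /=; lia.
rewrite -[X in _ <= X]addn0 -[X in _ <= _ + X]/(broken (State 0 N.+1 0 0)).
have : 0 < size ss by lia.
elim: ss {sk} (State _ _ _ _) => [|s ss IH] st //= _ gst ls /andP[s0 ss0].
have [gst' hl b1 _] := iter_jump s0 gst.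
case: ss IH ls ss0 => [|t ss] IH ls ss0.
  by case: gst' => /=; move: ls => /= ls; lia.
have [//|-> hb] := IH _ _ gst' ls ss0; split => //.
by rewrite (leq_trans hb) //=; lia.
Qed.

Local Open Scope ring_scope.

Let line_drops_mono (R : realType) (ss : seq nat) (x y : R) :
  x <= y -> line_drops [seq s%:R | s <- ss] x <= line_drops [seq s%:R | s <- ss] y.
Proof. by case: ss => //= s ss xy; rewrite lerD2r ler_wpM2r ?invr_ge0. Qed.

Lemma search_drops_le (R : realType) ss : (0 < n <= N)%N ->
  all (fun s => (1 <= s)%N) ss ->
  (drops (search N n ss))%:R <= line_drops [seq s%:R | s <- ss] (N%:R : R).
Proof.
move=> nN; rewrite /search; set st0 := State 0 N.+1 0 0.
have : good st0 by split => /=; lia.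
rewrite -[X in _ -> _ -> _ <= X]add0r -[0]/((drops st0)%:R).
have {2}-> : N = (hi st0 - lo st0 - 1)%N by rewrite /=; lia.
elim: ss (st0) => [|s ss IH] st gst /=; first by rewrite addr0.
move=> /andP[s0 ss0]; have [gst' hl _ [d hd ds]] := iter_jump s0 gst.
apply: le_trans (IH _ gst' ss0) _; rewrite hd natrD -addrA lerD2l.
have s0' : 0 < s%:R :> R by rewrite ltr0n.
apply: lerD; first by rewrite ler_pdivlMr// -natrM ler_nat.
by apply: line_drops_mono; rewrite -[X in _ - X]/(1%:R) -natrB// ler_nat; lia.
Qed.

End Adequacy.

(* Main.v *)
(** Let s_0 = N and let s_1, ..., s_k = 1 be the steps of an optimal schedule.
    Varying s_i alone gives s_i ^ 2 <= s_(i-1) * s_(i+1): if s_i > 1 this is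
    the first-order condition, if s_i = 1 it is clear.  So the sequence log s_i
    is convex, from log N down to 0, whence log s_1 <= (k - 1) / k * log N.
    Conversely, with r = N ^ (1/k), the integer steps ceil (r ^ (k - i)) cost
    each egg at most r drops in the worst case, k * r in total.  An optimal
    schedule exists because the minimal count for k eggs is a 1-Lipschitz
    function of the number of points, so that the count for k + 1 eggs is
    continuous in the first step, and that step stays bounded while the count
    does. *)

Require Import Defs.
From HB Require Import structures.
From mathcomp Require Import all_boot all_order all_algebra.
From mathcomp Require Import all_classical all_reals all_analysis.
From mathcomp Require Import ring lra.

Set Implicit Arguments.
Unset Strict Implicit.
Unset Printing Implicit Defensive.

Import Order.TTheory GRing.Theory Num.Theory.
Import numFieldNormedType.Exports.
Local Open Scope ring_scope.

(** * Schedules on the number line and their counts *)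

Lemma line_schedule1 (R : realType) (ss : seq R) :
  line_schedule 1 ss <-> ss = [:: 1].
Proof.
split=> [[]|->]; last by split; rewrite //= lexx.
by case: ss => [|s []] //= _ ->.
Qed.

Lemma line_schedule_cons (R : realType) k (s : R) ss :
  line_schedule k.+2 (s :: ss) <-> 1 <= s /\ line_schedule k.+1 ss.
Proof.
split=> [[/= [sz] ls /andP[s1 ss1]]|[s1 [sz ls ss1]]].
  by split=> //; split=> //; case: ss sz ls {ss1}.
by split; rewrite /= ?sz ?s1 //; case: ss sz ls {ss1}.
Qed.

Lemma line_schedule_nseq (R : realType) k :
  line_schedule k.+1 (nseq k.+1 (1 : R)).
Proof.
elim: k => [|k IH]; first exact/line_schedule1.
by apply/line_schedule_cons.
Qed.

Lemma line_drops_nseq (R : realType) k (x : R) :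
  line_drops (nseq k.+1 1) x = x.
Proof.
elim: k x => [|k IH] x; first by rewrite /= divr1 addr0.
by rewrite -[LHS]/(x / 1 + line_drops (nseq k.+1 1) (1 - 1)) IH divr1 subrr addr0.
Qed.

Lemma line_drops_ge0 (R : realType) (ss : seq R) x :
  all (fun s => 1 <= s) ss -> 0 <= x -> 0 <= line_drops ss x.
Proof.
elim: ss x => //= s ss IH x /andP[s1 ss1] x0.
by rewrite addr_ge0 ?IH ?subr_ge0 // divr_ge0 // (le_trans ler01).
Qed.

(** By induction the eggs after the first bound [s - 1] by [B], and the first egg bounds [x / s] by
    [M]; hence [x <= M * (1 + B)]. This confines the first step to a compact interval. *)
Lemma line_drops_coercive (R : realType) k (M : R) : 0 <= M ->
  exists2 B, 0 <= B & forall ss x, line_schedule k.+1 ss -> 0 <= x ->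
    line_drops ss x <= M -> x <= B.
Proof.
move=> M0; elim: k => [|k [B B0 IH]].
  exists M => // ss x /line_schedule1 -> _ /=; by rewrite divr1 addr0.
exists (M * (1 + B)) => [|[|s ss] x]; first by rewrite mulr_ge0 ?addr_ge0.
  by case.
move=> /line_schedule_cons[s1 sch] x0 /= le_M.
have s0 : 0 < s := lt_le_trans ltr01 s1.
have xs0 : 0 <= x / s by rewrite divr_ge0 // ltW.
have [_ _ ss1] := sch.
have t0 : 0 <= line_drops ss (s - 1) by rewrite line_drops_ge0 ?subr_ge0.
have sB : s - 1 <= B.
  by apply: (IH ss) => //; [rewrite subr_ge0 | lra].
have : x / s <= M by lra.
rewrite ler_pdivrMr // => /le_trans; apply; rewrite ler_wpM2l //; lra.
Qed.

(** * Existence of an optimal schedule *)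

Lemma exists_optimal_schedule (R : realType) k (x : R) :
  exists ss, optimal_schedule k.+1 x ss.
Proof.
elim: k x => [|k IH] x.
  exists [:: 1]; split; first exact/line_schedule1.
  by move=> tt /line_schedule1 ->.
(* For [x <= 0] a step above 1 only raises [x / s], so unit steps are optimal. *)
have [x0|x0] := leP x 0.
  exists (nseq k.+2 1); split=> [|[[]//|s tt] /line_schedule_cons[s1 [_ _ tt1]]].
    exact: line_schedule_nseq.
  rewrite line_drops_nseq /=.
  have s0 : 0 < s := lt_le_trans ltr01 s1.
  have : x <= x / s by rewrite ler_pdivlMr // ler_neMr.
  have : 0 <= line_drops tt (s - 1) by rewrite line_drops_ge0 ?subr_ge0.
  lra.
have [opt optP] := choice IH.
pose V y := line_drops (opt y) y.
have V_min tt y : line_schedule k.+1 tt -> V y <= line_drops tt y.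
  by have [_] := optP y; apply.
(* Use the optimal schedule for [z] on [y]: only the first term changes, by [(y - z) / s] with
   [s >= 1]. *)
have V_lip y z : V y <= V z + `|y - z|.
  have [sch _] := optP z; apply: le_trans (V_min _ _ sch) _.
  rewrite /V; case: (opt z) sch => [[]//|s ss [_ _ /= /andP[s1 _]]].
  have s0 : 0 < s := lt_le_trans ltr01 s1.
  have : (y - z) / s <= `|y - z|.
    rewrite ler_pdivrMr //; apply: (le_trans (ler_norm _)).
    by rewrite ler_peMr.
  rewrite mulrBl; lra.
have V_cont : continuous V.
  move=> y; apply/cvgrPdist_le => e e0; near=> z.
  have yz : `|y - z| <= e by near: z; apply: cvgr_dist_le.
  rewrite ler_norml; apply/andP; split.
    by have := V_lip z y; rewrite distrC; lra.
  by have := V_lip y z; lra.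
(* Unit steps count [x]. A first step beyond [1 + B] leaves more than [B] points, which alone cost
   more than [x]; so a minimum over [[1, 1 + B]] is global. *)
have [B B0 coer] := line_drops_coercive k (ltW x0).
have [||s] := @EVT_min _ (fun s => x / s + V (s - 1)) 1 (1 + B).
- by rewrite lerDl.
- apply: continuous_in_subspaceT => s; rewrite inE /= in_itv /= => /andP[s1 _].
  apply: cvgD.
    apply: cvgM; first exact: cvg_cst.
    by apply: cvgV; [rewrite gt_eqF // (lt_le_trans ltr01) | exact: cvg_id].
  have : {for s, continuous (V \o (fun s => s - 1))}; last exact.
  apply: continuous_comp; last exact: V_cont.
  by apply: cvgB; [exact: cvg_id | exact: cvg_cst].
rewrite in_itv /= => /andP[s1 _] smin.
exists (s :: opt (s - 1)); split.
  by apply/line_schedule_cons; split=> //; have [] := optP (s - 1).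
move=> [[]//|t tt] /line_schedule_cons[t1 sch] /=.
have t0 : 0 < t := lt_le_trans ltr01 t1.
have [tB|tB] := leP t (1 + B).
  apply: le_trans (smin t _) _; first by rewrite in_itv /= t1.
  by rewrite lerD2l V_min.
have /smin : (1 : R) \in `[1, 1 + B] by rewrite in_itv /= lexx lerDl.
move=> /le_trans; apply; rewrite divr1 subrr.
have := V_min _ 0 (line_schedule_nseq R k); rewrite line_drops_nseq.
have xt0 : 0 <= x / t by rewrite divr_ge0 // ltW.
have : x < line_drops tt (t - 1).
  rewrite ltNge; apply/negP => /(coer tt (t - 1) sch); rewrite subr_ge0 => /(_ t1).
  lra.
lra.
Unshelve. all: by end_near.
Qed.

(** * Upper bound on the optimal step *)

Lemma optimal_schedule_behead (R : realType) k (x s : R) ss :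
  optimal_schedule k.+2 x (s :: ss) -> optimal_schedule k.+1 (s - 1) ss.
Proof.
case=> /line_schedule_cons[s1 sch] opt; split=> // tt sch'.
have : line_schedule k.+2 (s :: tt) by apply/line_schedule_cons.
by move=> /opt /=; rewrite lerD2l.
Qed.

(* Were s ^+ 2 > x * t, the first two terms x / s + (s - 1) / t of the count
   would decrease when s is lowered slightly, which is possible if s > 1. *)
Lemma optimal_schedule_log_convex (R : realType) k (x y s t : R) ss :
  optimal_schedule k.+2 x (s :: t :: ss) -> x <= y -> 1 <= y ->
  s ^+ 2 <= y * t.
Proof.
case=> /line_schedule_cons[s1 sch] opt xy y1.
have t1 : 1 <= t by have [_ _ /andP[]] := sch.
have t0 : 0 < t := lt_le_trans ltr01 t1.
have s0 : 0 < s := lt_le_trans ltr01 s1.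
have [s_gt1|s_le1] := ltP 1 s; last first.
  have -> : s = 1 by apply/eqP; rewrite eq_le s_le1.
  by rewrite expr1n; nra.
apply: le_trans (_ : x * t <= _); last by rewrite ler_wpM2r // ltW.
rewrite leNgt; apply/negP => lt_s2.
(* Any [u] strictly between [m] and [s] is an admissible step with [x * t < u * s], which makes the
   factored difference of the counts positive. *)
pose m := Num.max 1 (x * t / s).
have ms : m < s by rewrite gt_max s_gt1 ltr_pdivrMr // -expr2.
pose u := (m + s) / 2.
have us : u < s by rewrite /u; lra.
have mu : m < u by rewrite /u; lra.
have u1 : 1 <= u by apply: ltW; apply: le_lt_trans mu; rewrite le_max lexx.
have u0 : 0 < u := lt_le_trans ltr01 u1.
have xu : x * t < u * s.
  by rewrite -ltr_pdivrMr //; apply: le_lt_trans mu; rewrite le_max lexx orbT.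
have /opt /= : line_schedule k.+2 (u :: t :: ss) by apply/line_schedule_cons.
rewrite leNgt => /negP; apply; rewrite !addrA ltrD2r.
rewrite -subr_gt0.
have -> : x / s + (s - 1) / t - (x / u + (u - 1) / t) =
  (s - u) * (u * s - x * t) / (s * u * t).
  by field; rewrite !gt_eqF.
by apply: divr_gt0; apply: mulr_gt0; rewrite ?subr_gt0 //; exact: mulr_gt0.
Qed.

(** The tail is optimal for [s - 1] points but is to be bounded in terms of [s], hence the separate
    [y >= x]. Induction gives [t ^+ k.+1 <= s ^+ k]; raising [s ^+ 2 <= y * t] to the power [k.+1]
    and cancelling [s ^+ k] concludes. *)
Lemma optimal_step_expr_le (R : realType) k (x y s : R) ss :
  optimal_schedule k.+1 x (s :: ss) -> x <= y -> 1 <= y ->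
  s ^+ k.+1 <= y ^+ k.
Proof.
elim: k x y s ss => [|k IH] x y s ss opt xy y1.
  by have [/line_schedule1[-> _] _] := opt; rewrite expr1 expr0.
have opt' := optimal_schedule_behead opt.
have [/line_schedule_cons[s1 [_ _ ss1]] _] := opt.
case: ss ss1 opt opt' => [_ _|t ss /= /andP[t1 _] opt opt']; first by case=> [[]].
have s0 : 0 < s := lt_le_trans ltr01 s1.
have y0 : 0 <= y := le_trans ler01 y1.
have t0 : 0 <= t := le_trans ler01 t1.
have tk : t ^+ k.+1 <= s ^+ k by apply: IH opt' _ s1; lra.
have s2 := optimal_schedule_log_convex opt xy y1.
rewrite -(ler_pM2r (exprn_gt0 k s0)) -exprD.
have -> : (k.+2 + k = 2 * k.+1)%N by rewrite mul2n -addnn addSnnS.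
rewrite exprM; apply: le_trans (_ : (y * t) ^+ k.+1 <= _).
  by rewrite lerXn2r // nnegrE ?sqr_ge0 // mulr_ge0.
by rewrite exprMn ler_wpM2l // exprn_ge0.
Qed.

(** * The geometric integer schedule *)

Lemma natr_absz_ceil (R : realType) (x : R) : 0 <= x ->
  (`|Num.ceil x|%N)%:R = (Num.ceil x)%:~R :> R.
Proof.
by move=> x0; rewrite natr_absz ger0_norm // ceil_ge0 (lt_le_trans _ x0) ?ltrN10.
Qed.

(** The exponent counts the eggs still in reserve, so the last step is [r ^+ 0 = 1]. *)
Fixpoint geometric_steps (R : realType) (r : R) (k : nat) : seq nat :=
  if k is j.+1 then `|Num.ceil (r ^+ j)|%N :: geometric_steps r j else [::].

Lemma geometric_steps_schedule (R : realType) (r : R) k : 1 <= r ->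
  schedule k.+1 (geometric_steps r k.+1).
Proof.
move=> r1; have r0 : 0 <= r := le_trans ler01 r1.
elim: k => [|k [sz ls ss1]].
  by split; rewrite //= expr0 ceil1.
split; [exact: (congr1 S sz) | exact: ls |].
apply/andP; split=> //.
rewrite -(ler_nat R) natr_absz_ceil ?exprn_ge0 //.
by apply: le_trans (ceil_ge _); rewrite exprn_ege1.
Qed.

Lemma line_schedule_natr (R : realType) k ss :
  schedule k.+1 ss -> line_schedule k.+1 [seq s%:R : R | s <- ss].
Proof.
case=> sz ls ss1; split; first by rewrite size_map.
  by case: ss sz ls {ss1} => //= s ss _; rewrite last_map => ->.
by rewrite all_map; apply: sub_all ss1 => s /=; rewrite ler1n.
Qed.

(* Rounding up is harmless: a step ceil (r ^+ j) leaves fewer than r ^+ j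
   points to the next egg. *)
Lemma geometric_steps_drops (R : realType) (r : R) k x : 1 <= r ->
  x <= r ^+ k ->
  line_drops [seq s%:R : R | s <- geometric_steps r k] x <= k%:R * r.
Proof.
move=> r1; have r0 : 0 < r := lt_le_trans ltr01 r1.
elim: k x => [|k IH] x xr /=; first by rewrite mul0r.
rewrite natr_absz_ceil ?exprn_ge0 ?(ltW r0) //.
rewrite -natr1 mulrDl mul1r [X in _ <= X]addrC lerD //.
  have c0 : r ^+ k <= (Num.ceil (r ^+ k))%:~R := ceil_ge _.
  rewrite ler_pdivrMr ?(lt_le_trans _ c0) ?exprn_gt0 //.
  by apply: le_trans xr _; rewrite exprS ler_wpM2l // ltW.
apply: IH; have := ceilB1_lt (r ^+ k); rewrite intrB mulr1z; exact: ltW.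
Qed.

(** * From counts on the line to the search procedure *)

Lemma exists_min_drops N k ss : schedule k ss ->
  exists2 P, min_drops N k P & (P <= worst_drops N ss)%N.
Proof.
move=> sch.
pose Q P := `[< exists2 tt, schedule k tt & worst_drops N tt = P >].
have exQ : exists P, Q P by exists (worst_drops N ss); apply/asboolP; exists ss.
have [P /asboolP PQ Pmin] := ex_minnP exQ.
have min tt : schedule k tt -> (P <= worst_drops N tt)%N.
  by move=> sch'; apply: Pmin; apply/asboolP; exists tt.
by exists P; [split | exact: min].
Qed.

Lemma worst_drops_le (R : realType) N k ss (b : R) : schedule k ss -> 0 <= b ->
  line_drops [seq s%:R | s <- ss] N%:R <= b -> (worst_drops N ss)%:R <= b.
Proof.
move=> [_ _ ss1] b0 le_b; rewrite /worst_drops.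
(* The hypothesis [0 <= b] covers the value 0 of an empty maximum. *)
elim/big_ind: _ => // [m n mb nb|i _]; first by rewrite /maxn; case: ifP.
by apply: le_trans le_b; apply: search_drops_le ss1; rewrite /= ltn_ord.
Qed.

Theorem theorem4p1 (R : realType) (N k : nat) (N_ge1 : (1 <= N)%N)
    (k_ge1 : (1 <= k)%N) :
  [/\ exists S : R, optimal_step k N%:R S,
      forall S : R, optimal_step k N%:R S ->
        S <= N%:R `^ ((k%:R - 1) / k%:R),
      forall P : R, min_line_drops k N%:R P ->
        P <= (Num.ceil (k%:R * N%:R `^ (k%:R^-1) : R))%:~R
    & exists2 P : nat, min_drops N k P &
        P%:Z <= Num.ceil (k%:R * N%:R `^ (k%:R^-1) : R)].
Proof.
case: k k_ge1 => // k _.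
have N1 : 1 <= N%:R :> R by rewrite ler1n.
set r : R := N%:R `^ (k.+1%:R^-1).
have r1 : 1 <= r by rewrite -(powRr0 (N%:R : R)) ler_powR.
have rX j : r ^+ j = N%:R `^ (j%:R / k.+1%:R).
  by rewrite -powR_mulrn ?powR_ge0 // -powRrM mulrC.
have rk : r ^+ k.+1 = N%:R by rewrite rX divff ?pnatr_eq0 // powRr1 ?ler0n.
have sch := geometric_steps_schedule k r1.
have kr : line_drops [seq s%:R : R | s <- geometric_steps r k.+1] N%:R <=
    k.+1%:R * r by apply: geometric_steps_drops; rewrite ?rk.
have kr0 : 0 <= k.+1%:R * r by rewrite mulr_ge0 // (le_trans ler01).
split.
- have [[|S ss] opt] := exists_optimal_schedule k (N%:R : R).
    by case: opt => [[]].
  by exists S, ss.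
- move=> S [ss opt].
  have [[_ _ /andP[S1 _]] _] := opt; have S0 : 0 <= S := le_trans ler01 S1.
  have -> : k.+1%:R - 1 = k%:R :> R by rewrite -natr1 addrK.
  (* Raised to the power [k.+1], the bound [r ^+ k] becomes [N ^ k]. *)
  rewrite -rX -(@ler_pXn2r _ k.+1) ?nnegrE ?exprn_ge0 ?(le_trans ler01 r1) //.
  by rewrite exprAC rk; apply: optimal_step_expr_le opt (lexx _) N1.
- move=> P [ss [_ opt] <-].
  apply: le_trans (ceil_ge _); apply: le_trans kr.
  (* The integer geometric schedule also competes on the line. *)
  exact/opt/line_schedule_natr.
- have [P Pmin Ple] := exists_min_drops N sch; exists P => //.
  rewrite -(ler_int R); apply: le_trans (ceil_ge _).
  apply: le_trans (worst_drops_le sch kr0 kr).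
  by rewrite -pmulrn ler_nat.
Qed.
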